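(* Let $G=(V,E)$ be a finite weighted graph with vertex measure $\mu$, let $k\in\mathbb{N}$ and let $s$ be an $S^1_k$-valued signature on $G$. Let $1\le p<\delta$ and suppose that $(G,s)$ has isoperimetric dimension $\delta$ with isoperimetric constant $c_\delta>0$. Define $q$ by $1/p=1/q+1/\delta$. Then there exists a constant $C$ depending only on $p,\delta,c_\delta$ and $d_\mu$ such that for every $f:V\to\mathbb{C}$, $$\left[\sum_{u\in V}|f(u)|^q\mu(u)\right]^{1/q}\le C\left[\sum_{\{u,v\}\in E}w_{uv}|f(u)-s_{uv}f(v)|^p\right]^{1/p}.$$
   Context: $G=(V,E)$ is an undirected simple finite graph; each edge $\{u,v\}\in E$ carries a weight $w_{uv}=w_{vu}>0$; $\mu:V\to(0,\infty)$ is a vertex measure; $d_u=\sum_{v\sim u}w_{uv}$ and $d_\mu=\max_{u\in V} d_u/\mu(u)$. For $X\subseteq V$, $|E(X,X^c)|=\sum_{u\in X,v\notin X}w_{uv}$ and $\mathrm{vol}_\mu(X)=\sum_{u\in X}\mu(u)$. $E^{or}$ is the set of oriented edges. $S^1_k=\{\xi^j:j=1,\dots,k\}$, $\xi=e^{2\pi i/k}$. A signature is a map $s:E^{or}\to S^1_k$ with $s_{vu}=s_{uv}^{-1}$. For nonempty $V_1\subseteq V$ with induced edge set $E_1$, $\iota^s(V_1)=\min_{\tau:V_1\to S^1_k}\sum_{\{u,v\}\in E_1}w_{uv}|\tau(u)-s_{uv}\tau(v)|$. $(G,s)$ has isoperimetric dimension $\delta$ with isoperimetric constant $c_\delta$ if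 for every nonempty $V_1\subseteq V$: $\iota^s(V_1)+|E(V_1,V_1^c)|\ge c_\delta\,\mathrm{vol}_\mu(V_1)^{(\delta-1)/\delta}$. *)

(* Defs.v *)
From HB Require Import structures.
From mathcomp Require Import all_boot all_order all_algebra.
From mathcomp Require Import all_classical all_reals all_analysis.
From mathcomp Require Import complex.

Set Implicit Arguments.
Unset Strict Implicit.
Unset Printing Implicit Defensive.

Import Order.TTheory GRing.Theory Num.Theory.

Local Open Scope ring_scope.
Local Open Scope complex_scope.

(* The real-valued modulus; the generic norm of [R[i]] takes values in [R[i]]. *)
Definition cmod (R : realType) (z : R[i]) : R := ComplexField.Normc.normc z.

Record wgraph (R : realType) := WGraph {
  vert :> finType;
  adj : rel vert;
  wt : vert -> vert -> R;
  mu : vert -> R;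
  adj_sym : forall u v, adj u v = adj v u;
  adj_irrefl : forall u, adj u u = false;
  wt_sym : forall u v, adj u v -> wt u v = wt v u;
  wt_gt0 : forall u v, adj u v -> 0 < wt u v;
  mu_gt0 : forall u, 0 < mu u }.

(* Sum of [F] over the unordered edges {u, v} with both ends in [A]. Each edge
   is met in both orientations, whence the factor 1/2; [F] is meant to take the
   same value on (u, v) and (v, u). *)
Definition edge_sum (R : realType) (G : wgraph R) (A : {set G})
    (F : G -> G -> R) : R :=
  (\sum_(u in A) \sum_(v in A | adj u v) F u v) / 2.

Definition degree (R : realType) (G : wgraph R) (u : G) : R :=
  \sum_(v | adj u v) wt u v.

(* All the ratios are nonnegative, so the seed 0 only matters if [G] is empty. *)
Definition dmu (R : realType) (G : wgraph R) : R :=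
  \big[Num.max/0]_(u : G) (degree u / mu u).

Definition edge_cut (R : realType) (G : wgraph R) (X : {set G}) : R :=
  \sum_(u in X) \sum_(v in ~: X | adj u v) wt u v.

Definition vol (R : realType) (G : wgraph R) (X : {set G}) : R :=
  \sum_(u in X) mu u.

Definition xi (R : realType) (k : nat) : R[i] :=
  cos (2 * pi / k%:R) +i* sin (2 * pi / k%:R).

Definition S1 (R : realType) (k : nat) : seq R[i] :=
  [seq xi R k ^+ j | j <- seq.iota 1 k].

Definition signature (R : realType) (G : wgraph R) (k : nat)
    (s : G -> G -> R[i]) : Prop :=
  forall u v, adj u v -> s u v \in S1 R k /\ s v u = (s u v)^-1.

Definition frustration (R : realType) (G : wgraph R) (s : G -> G -> R[i])
    (A : {set G}) (tau : G -> R[i]) : R :=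
  edge_sum A (fun u v => wt u v * cmod (tau u - s u v * tau v)).

(* The minimum of [frustration s A] over the S1 k-valued functions. They are
   taken on all vertices, but their values outside [A] are irrelevant. For
   0 < k the seed of the iterated minimum is the value at one of them, since
   1 = xi ^+ k belongs to [S1 k]. *)
Definition frustration_index (R : realType) (G : wgraph R) (k : nat)
    (s : G -> G -> R[i]) (A : {set G}) : R :=
  \big[Num.min/frustration s A (fun=> 1)]_(tau : {ffun G -> seq_sub (S1 R k)})
    frustration s A (fun u => val (tau u)).

Definition isoperimetric (R : realType) (G : wgraph R) (k : nat)
    (s : G -> G -> R[i]) (delta c : R) : Prop :=
  forall A : {set G}, A != finset.set0 ->
    c * vol A `^ ((delta - 1) / delta) <= frustration_index k s A + edge_cut A.

(* Main.v *)
(* The case p = 1 is a co-area argument. Cutting |g| into layers A_t = {t <= |g|}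
   and applying the isoperimetric inequality to each of them, it remains to bound
   the mean frustration index and the mean boundary of A_t. The boundary
   contributes at most | |g u| - |g v| | per edge. To bound the frustration
   index, choose tau by dividing the circle into k sectors and rotating them by
   a random angle: an edge then contributes in expectation at most the angle
   between g u and s_uv g v, whatever k is, and angle times min (|g u|, |g v|)
   is at most 4 |g u - s_uv g v|. Since V is finite, both averages (over t and
   over the rotation) can be taken over finitely many weighted thresholds.
   For p > 1 the case p = 1 is applied to g = |f|^(gamma - 1) f with
   gamma = q (delta - 1) / delta, followed by Hoelder's inequality. *)
Require Import Defs.
From mathcomp Require Import all_boot all_order all_algebra.
From mathcomp Require Import all_classical all_reals all_analysis.
From mathcomp Require Import complex ring lra.

Import Order.TTheory GRing.Theory Num.Theory.
Import numFieldNormedType.Exports.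

Local Open Scope ring_scope.

(** * Finite averages: layer cake, Hoelder's inequality, random rounding *)

(** Induction on the size of the support: subtracting the smallest positive value [a] and truncating
    at 0 removes at least one index from it. The layer taken off has weight and threshold [a]; the
    other thresholds are shifted by [a]. *)
Lemma layer_cake (R : realType) (I : finType) (x : I -> R) :
  (forall i, 0 <= x i) ->
  exists (n : nat) (w t : 'I_n -> R),
    [/\ forall j, 0 <= w j, forall j, 0 < t j &
        forall i, x i = \sum_j w j * (t j <= x i)%R%:R].
Proof.
move: {2}#|_| (leqnn #|[pred i | 0 < x i]|) => m.
elim: m x => [|m IHm] x lem x0.
  exists 0%N, (fun=> 0), (fun=> 1); split => // i; rewrite big_ord0.
  apply/eqP; rewrite eq_le x0 andbT leNgt; apply/negP => xi0.
  move: lem; rewrite leqn0 => /eqP/card0_eq/(_ i).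
  by rewrite inE xi0.
have [i0 xi0|no] := pickP [pred i | 0 < x i]; last first.
  by apply: IHm => //; rewrite eq_card0.
case: (@arg_minP _ _ _ i0 [pred i | 0 < x i] x xi0) => i1 /= a0 min_i1.
pose a := x i1; pose y i := Num.max (x i - a) 0.
have [||n [w [t [w0 t0 yE]]]] := IHm y.
- rewrite -ltnS; apply: (leq_trans _ lem); apply: proper_card.
  apply/fintype.properP; split; last first.
    by exists i1; rewrite !inE // /y /a subrr maxxx ltxx.
  apply/fintype.subsetP => i; rewrite !inE /y lt_max ltxx orbF subr_gt0.
  exact: lt_trans.
- by move=> i; rewrite /y le_max lexx orbT.
exists n.+1, (fun j => if unlift ord0 j is Some j' then w j' else a).
exists (fun j => if unlift ord0 j is Some j' then t j' + a else a).
split=> [j|j|i]; try by case: unliftP => [j' _|_]; rewrite ?addr_gt0 // ltW.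
rewrite big_ord_recl unlift_none.
under eq_bigr do rewrite liftK.
have -> : \sum_j w j * (t j + a <= x i)%R%:R = y i.
  rewrite yE; apply: eq_bigr => j _; congr (_ * _%:R); congr nat_of_bool.
  by rewrite /y le_max [t j <= 0]leNgt t0 orbF lerBrDr.
rewrite /y; have [->|xi] := eqVneq (x i) 0.
  by rewrite leNgt a0 mulr0 sub0r add0r max_r // oppr_le0 ltW.
have lea : a <= x i by apply: min_i1; rewrite lt_def xi x0.
by rewrite lea mulr1 max_l ?subr_ge0 // addrC subrK.
Qed.

(** Both factors are normalised to norm 1 and Young's inequality is summed termwise; if a norm
    vanishes, so does every term on the left. *)
Lemma hoelder_fin (R : realType) (I : finType) (m x y : I -> R) (p q : R) :
  (forall i, 0 <= m i) -> (forall i, 0 <= x i) -> (forall i, 0 <= y i) ->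
  0 < p -> 0 < q -> p^-1 + q^-1 = 1 ->
  \sum_i m i * (x i * y i) <=
  (\sum_i m i * x i `^ p) `^ p^-1 * (\sum_i m i * y i `^ q) `^ q^-1.
Proof.
move=> m0 x0 y0 p0 q0 pq.
have [A0 B0] : (0 <= \sum_i m i * x i `^ p) /\ (0 <= \sum_i m i * y i `^ q).
  by split; apply: sumr_ge0 => i _; rewrite mulr_ge0 ?powR_ge0.
have vanish (z : I -> R) r : (forall i, 0 <= z i) ->
    \sum_i m i * z i `^ r = 0 -> forall i, m i * z i = 0.
  move=> z0 /eqP; rewrite psumr_eq0; last first.
    by move=> i _; rewrite mulr_ge0 ?powR_ge0.
  move=> /allP zr i; have /zr := mem_index_enum i.
  rewrite /= mulf_eq0 powR_eq0 => /orP[/eqP->|/andP[/eqP-> _]].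
    by rewrite mul0r.
  by rewrite mulr0.
have normalized (z M r : R) : 0 <= z -> 0 <= M -> 0 < r ->
    (z / M `^ r^-1) `^ r = z `^ r / M.
  move=> z0 M0 r0; rewrite powRM ?invr_ge0 ?powR_ge0 //; congr (_ * _).
  rewrite -[X in X `^ r]powR_inv1 ?powR_ge0 // -!powRrM mulN1r mulrN mulVf ?gt_eqF //.
  by rewrite powR_inv1.
have [Az|An] := eqVneq (\sum_i m i * x i `^ p) 0.
  rewrite big1 ?mulr_ge0 ?powR_ge0 // => i _.
  by rewrite mulrA (vanish x p) // mul0r.
have [Bz|Bn] := eqVneq (\sum_i m i * y i `^ q) 0.
  rewrite big1 ?mulr_ge0 ?powR_ge0 // => i _.
  by rewrite mulrCA (vanish y q) // mulr0.
move: A0 B0 An Bn.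
move AE : (\sum_i m i * x i `^ p) => A; move BE : (\sum_i m i * y i `^ q) => B.
move=> A0 B0 An Bn.
have a0 : 0 < A `^ p^-1 by rewrite powR_gt0 // lt_def An.
have b0 : 0 < B `^ q^-1 by rewrite powR_gt0 // lt_def Bn.
rewrite -[leRHS]mul1r -ler_pdivrMr ?(mulr_gt0 a0 b0) // mulr_suml.
apply: (@le_trans _ _
  (\sum_i ((A * p)^-1 * (m i * x i `^ p) + (B * q)^-1 * (m i * y i `^ q)))).
  apply: ler_sum => i _.
  have := @conjugate_powR R (x i / A `^ p^-1) (y i / B `^ q^-1) p q
    (divr_ge0 (x0 i) (powR_ge0 _ _)) (divr_ge0 (y0 i) (powR_ge0 _ _)) p0 q0 pq.
  rewrite (normalized _ _ _ (x0 i) A0 p0) (normalized _ _ _ (y0 i) B0 q0).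
  move=> /(ler_wpM2l (m0 i)) H.
  apply: le_trans (le_trans H _); rewrite le_eqVlt; apply/orP; left; apply/eqP.
    by rewrite invfM; ring.
  by rewrite !invfM; ring.
rewrite big_split -!mulr_sumr AE BE /= !invfM mulrAC mulVf // mul1r.
by rewrite [X in _ + X]mulrAC mulVf // mul1r pq.
Qed.

(* A random rounding of the reals [X i] to integers, monotone and equivariant
   under integer shifts for every outcome [j], and unbiased; the thresholds are
   a layer cake of the fractional parts. *)
Lemma rounding (R : realType) (I : finType) (X : I -> R) :
  exists (n : nat) (w : 'I_n -> R) (F : 'I_n -> I -> int),
    [/\ forall j, 0 <= w j, \sum_j w j = 1 &
        forall i i' (M : int),
          \sum_j w j * `|(F j i - F j i' - M)%:~R| = `|X i - X i' - M%:~R|].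
Proof.
pose fr i := X i - (Num.floor (X i))%:~R.
have fr0 i : 0 <= fr i by rewrite subr_ge0 floor_le.
have fr1 i : fr i <= 1.
  by rewrite lerBlDl -intrD1 ltW // floorD1_gt.
(* The extra index [None], of value 1, makes the weights of the layers with [t j <= 1] sum to 1, so
   that these layers form a probability distribution. *)
pose x (o : option I) := if o is Some i then fr i else 1.
have [|n [w [t [w0 t0 xE]]]] := @layer_cake R (option I) x.
  by case=> [i|] //=.
pose F j i : int := Num.floor (X i) + Posz (t j <= fr i)%R.
have w1 : \sum_j w j * (t j <= 1)%R%:R = 1 by rewrite -(xE None).
have EF i : \sum_j (w j * (t j <= 1)%R%:R) * (F j i)%:~R = X i.
  rewrite /F; under eq_bigr do rewrite intrD mulrDr.
  rewrite big_split /= -mulr_suml w1 mul1r.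
  rewrite -[RHS](subrK (Num.floor (X i))%:~R) addrC; congr (_ + _).
  rewrite -[RHS]/(x (Some i)) xE; apply: eq_bigr => j _ /=.
  rewrite -mulrA; congr (_ * _); have [tfr|_] /= := leP (t j) (fr i).
    by rewrite (le_trans tfr (fr1 i)) mulr1.
  by rewrite mulr0.
(* If the two floors agree, the fractional parts are ordered and so are the rounding increments;
   otherwise the floors differ by at least 1, which absorbs an increment. *)
have mono i i' (M : int) j : X i' + M%:~R <= X i -> F j i' + M <= F j i.
  move=> le; have flD : Num.floor (X i' + M%:~R) = Num.floor (X i') + M.
    by rewrite floorDrz ?intr_int // intrKfloor.
  have := le_floor le; rewrite flD /F le_eqVlt => /orP[/eqP flE|].
    have frle : fr i' <= fr i.
      rewrite /fr -flE intrD; lra.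
    have b : (nat_of_bool (t j <= fr i')%R <= nat_of_bool (t j <= fr i)%R)%N.
      by have [tfr|//] := leP (t j) (fr i'); rewrite (le_trans tfr).
    by rewrite -flE addrAC lerD2l lez_nat.
  rewrite -lezD1 => lt; apply: (@le_trans _ _ (Num.floor (X i') + M + 1)).
    by rewrite addrAC lerD2l; case: (t j <= fr i')%R.
  by apply: (le_trans lt); rewrite lerDl.
exists n, (fun j => w j * (t j <= 1)%R%:R), F; split => //.
  by move=> j; rewrite mulr_ge0.
move=> i i' M.
have ED : \sum_j (w j * (t j <= 1)%R%:R) * (F j i - F j i' - M)%:~R =
    X i - X i' - M%:~R.
  under eq_bigr do rewrite !intrB !mulrBr.
  by rewrite !sumrB !EF -mulr_suml w1 mul1r.
(* By [mono] the rounded difference has the same sign for all [j], so the absolute value commutes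
   with the mean. *)
have [le|/ltW le] := leP (X i' + M%:~R) (X i).
  rewrite ger0_norm; last by lra.
  rewrite -ED; apply: eq_bigr => j _; rewrite ger0_norm // ler0z.
  by have := mono _ _ _ j le; lra.
rewrite ler0_norm; last by lra.
rewrite -ED -sumrN; apply: eq_bigr => j _; rewrite -mulrN ler0_norm // lerz0.
have le' : X i + (- M)%:~R <= X i' by rewrite mulrNz; lra.
by have := mono _ _ _ j le'; lra.
Qed.

(** * Modulus and polar form of complex numbers *)

Lemma cmod_ge0 (R : realType) (z : R[i]) : 0 <= cmod z.
Proof. by case: z => a b; exact: sqrtr_ge0. Qed.

Lemma cmodM (R : realType) (z w : R[i]) : cmod (z * w) = cmod z * cmod w.
Proof. exact: ComplexField.Normc.normcM. Qed.

Lemma cmodN (R : realType) (z : R[i]) : cmod (- z) = cmod z.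
Proof. exact: normcN. Qed.

Lemma ler_cmodD (R : realType) (z w : R[i]) :
  cmod (z + w) <= cmod z + cmod w.
Proof. exact: le_normcD. Qed.

Lemma ler_dist_cmod (R : realType) (z w : R[i]) :
  `|cmod z - cmod w| <= cmod (z - w).
Proof.
rewrite ler_norml; apply/andP; split.
  rewrite -cmodN opprB; have := @ler_cmodD R z (w - z).
  by rewrite addrC subrK; lra.
have := @ler_cmodD R w (z - w).
by rewrite addrC subrK; lra.
Qed.

Lemma cmod_real (R : realType) (r : R) : 0 <= r -> cmod r%:C%C = r.
Proof. by move=> r0; rewrite /cmod /= expr0n addr0 sqrtr_sqr ger0_norm. Qed.

Lemma sqr_cmod (R : realType) (a b : R) : cmod (a +i* b)%C ^+ 2 = a ^+ 2 + b ^+ 2.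
Proof. by rewrite sqr_sqrtr // addr_ge0 ?sqr_ge0. Qed.

Definition cis (R : realType) (x : R) : R[i] := (cos x +i* sin x)%C.
Arguments cis {R} x.

Lemma cisD (R : realType) (x y : R) : cis (x + y) = cis x * cis y.
Proof.
rewrite /cis cosD sinD; apply/eqP; rewrite eq_complex /= eqxx /=.
by apply/eqP; ring.
Qed.

Lemma cis0 (R : realType) : cis 0 = 1 :> R[i].
Proof. by rewrite /cis cos0 sin0. Qed.

Lemma cisX (R : realType) (x : R) n : cis x ^+ n = cis (x * n%:R).
Proof.
elim: n => [|n IHn]; first by rewrite mulr0 cis0.
by rewrite exprS IHn -cisD -natr1 mulrDr mulr1 addrC.
Qed.

Lemma cmod_cis (R : realType) (x : R) : cmod (cis x) = 1.
Proof. by rewrite /cmod /= cos2Dsin2 sqrtr1. Qed.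

Lemma cis_2pi (R : realType) (n : int) : cis (2 * pi * n%:~R) = 1 :> R[i].
Proof.
have cisn m : cis (2 * pi * m%:R) = 1 :> R[i].
  rewrite -cisX /cis.
  have -> : 2 * pi = pi *+ 2 :> R by rewrite mulr_natl.
  by rewrite cos2pi sin2pi expr1n.
case: n => n; first exact: cisn.
rewrite NegzE mulrNz mulrN -[LHS]mulr1 -[X in _ * X](cisn n.+1) -cisD.
by rewrite addNr cis0.
Qed.

Lemma polar (R : realType) (z : R[i]) :
  exists a : R, z = (cmod z)%:C%C * cis a.
Proof.
have [->|z0] := eqVneq z 0.
  by exists 0; rewrite /cmod ComplexField.Normc.normc0 mul0r.
case: z z0 => x y z0; set r := cmod _.
have r2 : r ^+ 2 = x ^+ 2 + y ^+ 2 by rewrite sqr_cmod.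
have r0 : 0 < r.
  rewrite lt_def cmod_ge0 andbT; apply: contra z0.
  by move=> /eqP/ComplexField.Normc.eq0_normc ->.
have xr : x ^+ 2 <= r ^+ 2 by rewrite r2 lerDl sqr_ge0.
have x1 : -1 <= x / r <= 1.
  rewrite -ler_norml normrM normfV (gtr0_norm r0) ler_pdivrMr // mul1r.
  by rewrite -ler_sqr ?nnegrE ?(ltW r0) // real_normK ?num_real.
have s2 : Num.sqrt (1 - (x / r) ^+ 2) = `|y| / r.
  have -> : 1 - (x / r) ^+ 2 = (y / r) ^+ 2.
    rewrite !expr_div_n -[X in X - _](@mulfV _ (r ^+ 2)) ?expf_neq0 ?gt_eqF //.
    by rewrite -mulrBl r2; congr (_ / _); ring.
  by rewrite sqrtr_sqr normrM normfV (gtr0_norm r0).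
have rn : r != 0 by rewrite gt_eqF.
(* [acos] reaches the upper half circle only; the sign of [y] decides between the angle and its
   opposite. *)
have [y0|/ltW y0] := leP 0 y.
  exists (acos (x / r)).
  rewrite /cis acosK ?in_itv //= sin_acos // s2 ger0_norm //.
  by apply/eqP; rewrite eq_complex /= !mul0r subr0 addr0 ![r * _]mulrC !divfK ?eqxx.
exists (- acos (x / r)).
rewrite /cis cosN sinN acosK ?in_itv //= sin_acos // s2 ler0_norm //.
apply/eqP; rewrite eq_complex /= !mul0r subr0 addr0 ![r * _]mulrC !mulNr opprK.
by rewrite !divfK ?eqxx.
Qed.

(** * Comparison of angles with chords *)

Lemma sin_le (R : realType) (x : R) : 0 <= x -> sin x <= x.
Proof.
move=> x0.
have [|c _] := @MVT_segment R sin cos 0 x x0.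
  by apply: continuous_subspaceT => y; exact: continuous_sin.
by rewrite sin0 !subr0 => ->; rewrite ler_piMl // cos_le1.
Qed.

Lemma norm_sin_le (R : realType) (x : R) : `|sin x| <= `|x|.
Proof.
wlog x0 : x / 0 <= x.
  move=> H; have [/H//|/ltW x0] := leP 0 x.
  by rewrite -normrN -sinN -[`|x|]normrN; apply: H; rewrite oppr_ge0.
rewrite (ger0_norm x0).
have [x1|x1] := leP x 1.
  rewrite ger0_norm ?sin_le //; apply: sin_ge0_pi; rewrite x0 /=.
  by apply: le_trans x1 _; have := pi_ge2 R; lra.
by apply: le_trans (sin_max x) (ltW x1).
Qed.

(** The mean value theorem is applied at [x / 2], so that the intermediate point stays below pi / 4,
    where the cosine is at least 1/2; monotonicity of the sine then passes from [x / 2] to [x]. *)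
Lemma sin_ge (R : realType) (x : R) : 0 <= x <= pi / 2 -> x / 4 <= sin x.
Proof.
move=> /andP[x0 x1].
have pi0 := pi_ge0 R.
have le : sin (x / 2) <= sin x.
  have [->|xn] := eqVneq x 0; first by rewrite mul0r.
  have xgt : 0 < x by rewrite lt_def xn.
  by apply: ltW; rewrite ltr_sin ?in_itv /=; try (apply/andP; split); lra.
apply: le_trans le.
have [c [c0 cx ->]] : exists c, [/\ 0 <= c, c <= x / 2 & sin (x / 2) = cos c * (x / 2)].
  have [||c] := @MVT_segment R sin cos 0 (x / 2).
  - by lra.
  - by apply: continuous_subspaceT => y; exact: continuous_sin.
  by rewrite in_itv /= sin0 !subr0 => /andP[]; exists c.
have cos0 : 0 <= cos (c *+ 2).
  by apply: cos_ge0_pihalf; rewrite [c *+ 2]mulr2n; apply/andP; split; lra.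
have cosc0 : 0 <= cos c.
  by apply: cos_ge0_pihalf; apply/andP; split; lra.
have cosc : 1 / 2 <= cos c.
  rewrite -ler_sqr ?nnegrE ?divr_ge0 // exprMn exprVn.
  by move: cos0; rewrite cos_mulr2n [_ ^+ 2 *+ 2]mulr2n; lra.
by nra.
Qed.

Lemma sqr_cmod_cisB (R : realType) (a b : R) :
  cmod (cis a - cis b) ^+ 2 = 2 - 2 * cos (a - b).
Proof.
rewrite sqr_cmod /= cosB; have := cos2Dsin2 a; have := cos2Dsin2 b.
by move=> Hb Ha; nra.
Qed.

Lemma cmod_cisB (R : realType) (a b : R) :
  cmod (cis a - cis b) = 2 * `|sin ((a - b) / 2)|.
Proof.
apply/eqP; rewrite -(@eqrXn2 _ 2) ?cmod_ge0 ?mulr_ge0 //.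
rewrite sqr_cmod_cisB exprMn real_normK ?num_real // sin2cos2.
have {1}-> : a - b = ((a - b) / 2) *+ 2 by rewrite -mulr_natr divfK.
by rewrite cos_mulr2n; apply/eqP; ring.
Qed.

Lemma cmod_cisB_le (R : realType) (a b : R) :
  cmod (cis a - cis b) <= `|a - b|.
Proof.
rewrite cmod_cisB; have := @norm_sin_le R ((a - b) / 2).
by rewrite normrM [`|2^-1|]ger0_norm //; lra.
Qed.

(** The chord is twice the sine of half the angle; the bound [pi] keeps the half angle within the
    range of [sin_ge]. *)
Lemma cmod_cisB_ge (R : realType) (a b : R) :
  `|a - b| <= pi -> `|a - b| <= 4 * cmod (cis a - cis b).
Proof.
move=> ab; rewrite cmod_cisB.
have -> : `|sin ((a - b) / 2)| = `|sin (`|a - b| / 2)|.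
  by case: (ger0P (a - b)) => // _; rewrite mulNr sinN normrN.
have := @sin_ge R (`|a - b| / 2).
have -> : 0 <= `|a - b| / 2 <= pi / 2.
  by have := normr_ge0 (a - b); move=> ?; apply/andP; split; lra.
move=> /(_ isT) H; have := le_trans H (ler_norm _); lra.
Qed.

(** The squared distance equals (r - t)^2 plus r t times the squared chord between the phases, and r
    t is at least the square of the minimum. *)
Lemma min_angle_le (R : realType) (r t a b : R) : 0 <= r -> 0 <= t ->
  `|a - b| <= pi ->
  Num.min r t * `|a - b| <= 4 * cmod (r%:C%C * cis a - t%:C%C * cis b).
Proof.
move=> r0 t0 /cmod_cisB_ge ab; set m := Num.min r t.
have m0 : 0 <= m by rewrite le_min r0 t0.
have [mr mt] : m <= r /\ m <= t by split; rewrite ge_min lexx ?orbT.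
apply: (le_trans (ler_wpM2l m0 ab)); rewrite mulrCA ler_pM2l //.
rewrite -ler_sqr ?nnegrE ?mulr_ge0 ?cmod_ge0 // exprMn sqr_cmod_cisB.
rewrite sqr_cmod /= !mul0r !subr0 !addr0 cosB.
have := cos2Dsin2 a; have := cos2Dsin2 b; have := cos_le1 (a - b); rewrite cosB.
move: (cos a) (cos b) (sin a) (sin b) => ca cb sa sb Hc Hb Ha.
have -> : (r * ca - t * cb) ^+ 2 + (r * sa - t * sb) ^+ 2 =
    (r - t) ^+ 2 + r * t * (2 - 2 * (ca * cb + sa * sb)).
  transitivity (r ^+ 2 * (ca ^+ 2 + sa ^+ 2) + t ^+ 2 * (cb ^+ 2 + sb ^+ 2) -
    2 * r * t * (ca * cb + sa * sb)); first by ring.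
  by rewrite Ha Hb; ring.
apply: (@le_trans _ _ (r * t * (2 - 2 * (ca * cb + sa * sb)))).
  by apply: ler_wpM2r; [lra | rewrite expr2 ler_pM].
by rewrite lerDr sqr_ge0.
Qed.

(** * Roots of unity and the frustration index *)

Lemma xiE (R : realType) k : xi R k = cis (2 * pi / k%:R).
Proof. by []. Qed.

Lemma cis_S1 (R : realType) (k : nat) (m : int) : (0 < k)%N ->
  cis (2 * pi / k%:R * m%:~R) \in S1 R k.
Proof.
move=> k0; have kR : k%:R != 0 :> R by rewrite pnatr_eq0 -lt0n.
have kz : (k%:Z != 0) by rewrite eqz_nat -lt0n.
(* [S1] lists the exponents 1 to [k], so remainder 0 is replaced by [k] and the quotient lowered by
   1. *)
have [r [N [rk mE]]] : exists r : nat, exists N : int,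
    (1 <= r < k.+1)%N /\ m = N * k%:Z + r%:Z.
  have := divz_eq m k; have := modz_ge0 m kz; have := ltz_mod m kz.
  case: (m %% k)%Z => [[|r]|r] rk r0 mE; last by [].
    exists k, ((m %/ k)%Z - 1); split; first by rewrite k0 ltnSn.
    by rewrite {1}mE mulrBl mul1r addr0 subrK.
  exists r.+1, (m %/ k)%Z; split=> //.
  by move: rk; rewrite ger0_norm // ltz_nat => /ltnW.
have -> : cis (2 * pi / k%:R * m%:~R) = xi R k ^+ r.
  rewrite xiE cisX mE intrD intrM.
  have -> : 2 * pi / k%:R * (N%:~R * k%:R + r%:R) =
      2 * pi * N%:~R + 2 * pi / k%:R * r%:R :> R by field.
  by rewrite cisD cis_2pi mul1r.
by apply/mapP; exists r => //; rewrite mem_iota.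
Qed.

Lemma reduce_angle (R : realType) (y : R) :
  exists N : int, `|y - 2 * pi * N%:~R| <= pi.
Proof.
have pi0 : 0 < pi :> R := pi_gt0 R.
(* This floor is an integer nearest to [z], hence at most half a turn away. *)
pose z := y / (2 * pi); exists (Num.floor (z + 1 / 2)).
set N := Num.floor _.
have := floor_le (z + 1 / 2); have := floorD1_gt (z + 1 / 2).
rewrite -/N intrD => zu zl.
have -> : y - 2 * pi * N%:~R = 2 * pi * (z - N%:~R).
  have E (P : R) : P != 0 -> y - 2 * P * N%:~R = 2 * P * (y / (2 * P) - N%:~R).
    by move=> P0; field.
  by apply: E; rewrite gt_eqF.
rewrite normrM gtr0_norm ?mulr_gt0 //.
have : `|z - N%:~R| <= 1 / 2 by rewrite ler_norml; apply/andP; split; lra.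
by move=> H; nra.
Qed.

(* [alpha u v] is the angle between [g u] and [s u v * g v]; the bound comes from
   averaging the frustration of [u |-> xi ^ (F j u)] over the weights [w j],
   where [F j] rounds the phases of [g] measured in units of 2 pi / k. *)
Lemma frustration_index_angle (R : realType) (G : wgraph R) (k : nat)
    (s : G -> G -> R[i]) (g : G -> R[i]) :
  (0 < k)%N -> signature k s ->
  exists alpha : G -> G -> R,
    (forall u v, adj u v ->
       Num.min (cmod (g u)) (cmod (g v)) * alpha u v <=
       4 * cmod (g u - s u v * g v)) /\
    (forall A : {set G}, frustration_index k s A <=
       edge_sum A (fun u v => wt u v * alpha u v)).
Proof.
move=> k0 sig; have kR : 0 < k%:R :> R by rewrite ltr0n.
(* In units of the sector angle [h], the elements of [S1 R k] have integer phases. *)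
pose h : R := 2 * pi / k%:R.
have h0 : 0 < h by rewrite divr_gt0 ?mulr_gt0 ?pi_gt0.
have hk : 2 * pi = h * k%:R by rewrite divfK // gt_eqF.
have /choice[a ga] : forall u, exists a, g u = (cmod (g u))%:C%C * cis (h * a).
  by move=> u; have [a ->] := polar _ (g u); exists (a / h);
    rewrite cmodM cmod_cis mulr1 cmod_real ?cmod_ge0 // mulrCA divff ?mulr1 ?gt_eqF.
(* [M] is the phase of the signature, shifted by a multiple of [k] that brings the angle between
   [g u] and [s u v * g v] into [-pi, pi]. *)
have /choice[M MP] : forall e : G * G, exists M : int, adj e.1 e.2 ->
    s e.1 e.2 = cis (h * M%:~R) /\ `|h * (a e.1 - a e.2 - M%:~R)| <= pi.
  move=> [u v] /=; case: (boolP (adj u v)) => [uv|_]; last by exists 0.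
  have [/mapP[m _ sE] _] := sig u v uv.
  have [N HN] := reduce_angle _ (h * (a u - a v - m%:R)).
  exists (m%:Z + N * k%:Z) => _; rewrite intrD intrM; split.
    rewrite mulrDr cisD mulrCA -hk mulrC [_%:~R * _]mulrC cis_2pi mul1r.
    by rewrite sE xiE cisX.
  by apply: le_trans HN; rewrite hk le_eqVlt; apply/orP; left;
    apply/eqP; congr `|_|; ring.
have [n [w [F [w0 w1 EF]]]] := @rounding R G a.
exists (fun u v => h * `|a u - a v - (M (u, v))%:~R|); split.
- move=> u v uv; have [sE ang] := MP (u, v) uv.
  have := @min_angle_le R _ _ (h * a u) (h * (a v + (M (u, v))%:~R))
    (cmod_ge0 _ (g u)) (cmod_ge0 _ (g v)).
  rewrite -mulrBr opprD addrA => /(_ ang).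
  rewrite normrM (gtr0_norm h0) mulrDr cisD -ga.
  by rewrite [cis _ * cis _]mulrC [_%:C%C * (_ * _)]mulrCA -ga -sE.
- move=> A.
  pose tau j u := cis (h * (F j u)%:~R).
  have le_tau j : frustration_index k s A <= frustration s A (tau j).
    pose T : {ffun G -> seq_sub (S1 R k)} :=
      [ffun u => SeqSub (@cis_S1 R k (F j u) k0)].
    have -> : tau j = fun u => val (T u) by apply/funext => u; rewrite ffunE.
    exact: bigmin_le.
  (* A minimum lies below any average, here the one over [j]. *)
  rewrite -[leLHS]mul1r -[X in X * _ <= _]w1 mulr_suml.
  apply: (le_trans (ler_sum _ (fun j _ => ler_wpM2l (w0 j) (le_tau j)))).
  rewrite /frustration /edge_sum.
  under eq_bigr do rewrite mulrA mulr_sumr.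
  rewrite -mulr_suml ler_pM2r // exchange_big /=; apply: ler_sum => u _.
  under eq_bigr do rewrite mulr_sumr.
  rewrite exchange_big /=; apply: ler_sum => v /andP[_ uv].
  (* [EF] writes [alpha u v] as the mean of the rounded angles, each of which bounds its chord. *)
  rewrite /= -EF !mulr_sumr; apply: ler_sum => j _.
  rewrite mulrCA ler_wpM2l ?(ltW (wt_gt0 uv)) // mulrCA ler_wpM2l //.
  have [-> _] := MP (u, v) uv.
  rewrite /tau -cisD -mulrDr; apply: le_trans (cmod_cisB_le _ _ _) _.
  rewrite -mulrBr normrM (gtr0_norm h0) !intrB /= ler_wpM2l ?(ltW h0) //.
  by rewrite opprD addrA addrAC.
Qed.

(** * The case p = 1 by co-area *)

Lemma powR_norm_layer_cake (R : realType) (I : finType) (m x : I -> R)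
    (n : nat) (w t : 'I_n -> R) (r : R) :
  (forall i, 0 <= m i) -> (forall i, 0 <= x i) -> (forall j, 0 <= w j) ->
  (forall i, x i = \sum_j w j * (t j <= x i)%R%:R) -> 1 < r ->
  (\sum_i m i * x i `^ r) `^ r^-1 <=
  \sum_j w j * (\sum_i m i * (t j <= x i)%R%:R) `^ r^-1.
Proof.
move=> m0 x0 w0 xE r1; have r0 : 0 < r by lra.
have S0 : 0 <= \sum_i m i * x i `^ r.
  by apply: sumr_ge0 => i _; rewrite mulr_ge0 ?powR_ge0.
move SE : (\sum_i m i * x i `^ r) S0 => S; rewrite le_eqVlt => /orP[/eqP <-|S0].
  rewrite powR0 ?invr_eq0 ?gt_eqF //.
  by apply: sumr_ge0 => j _; rewrite mulr_ge0 ?powR_ge0.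
pose r' := r / (r - 1); have r10 : 0 < r - 1 by lra.
have r'0 : 0 < r' by rewrite divr_gt0.
have rr' : r^-1 + r'^-1 = 1 by rewrite /r'; field; rewrite !gt_eqF.
have r1r' : (r - 1) * r' = r by rewrite /r' mulrC divfK ?gt_eqF.
rewrite -(ler_pM2r (powR_gt0 r'^-1 S0)) -powRD; last first.
  by rewrite rr' oner_eq0.
rewrite rr' powRr1 ?(ltW S0) //.
have SL : S = \sum_j w j * \sum_i m i * ((t j <= x i)%R%:R * x i `^ (r - 1)).
  rewrite -SE; under [RHS]eq_bigr do rewrite mulr_sumr.
  rewrite exchange_big; apply: eq_bigr => i _ /=.
  rewrite -mulr_powRB1 // {1}xE mulr_suml mulr_sumr.
  by apply: eq_bigr => j _; rewrite -!mulrA mulrCA.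
rewrite [leLHS]SL mulr_suml; apply: ler_sum => j _; rewrite -mulrA ler_wpM2l //.
have := @hoelder_fin R I m (fun i => (t j <= x i)%R%:R)
  (fun i => x i `^ (r - 1)) r r' m0 (fun=> ler0n _ _) (fun=> powR_ge0 _ _)
  r0 r'0 rr'.
under [X in _ * X `^ _]eq_bigr do rewrite -powRrM r1r'.
rewrite SE; under [X in X `^ _ * _]eq_bigr => i _.
  have -> : (t j <= x i)%R%:R `^ r = (t j <= x i)%R%:R :> R.
    by case: (t j <= x i)%R; rewrite ?powR1 // powR0 // gt_eqF.
  over.
by [].
Qed.

(** With indicators the index sets no longer depend on the layer, so the sum over layers can be
    exchanged with the sum over edges. *)
Lemma big_adj_indicator (R : realType) (G : wgraph R) (A B : {set G})
    (F : G -> G -> R) :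
  \sum_(u in A) \sum_(v in B | adj u v) F u v =
  \sum_u \sum_(v | adj u v) (u \in A)%:R * (v \in B)%:R * F u v.
Proof.
rewrite big_mkcond /=; apply: eq_bigr => u _.
case: (u \in A); last by rewrite big1 // => v _; rewrite !mul0r.
rewrite big_mkcondl /=; apply: eq_bigr => v _.
by case: (v \in B); rewrite /= mul1r ?mul1r ?mul0r.
Qed.

(** The constant is 3 = 4/2 + 1 per oriented edge: the angle bound 4 halved by [edge_sum], plus 1
    for the boundary. *)
Lemma sobolev_L1 (R : realType) (G : wgraph R) (k : nat) (s : G -> G -> R[i])
    (delta c : R) (g : G -> R[i]) :
  (0 < k)%N -> signature k s -> 0 <= c -> 1 < delta ->
  isoperimetric k s delta c ->
  c * (\sum_u cmod (g u) `^ (delta / (delta - 1)) * mu u)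
        `^ ((delta - 1) / delta) <=
  3 * \sum_u \sum_(v | adj u v) wt u v * cmod (g u - s u v * g v).
Proof.
move=> k0 sig c0 delta1 iso.
have [alpha [alphaE frus]] := @frustration_index_angle R G k s g k0 sig.
have [n [w [t [w0 t0 gE]]]] :=
  @layer_cake R G (fun u => cmod (g u)) (fun u => cmod_ge0 _ _).
pose A j : {set G} := [set u | t j <= cmod (g u)]%SET.
have d1 : 0 < delta - 1 by lra.
have d0 : 0 < delta by lra.
pose r := delta / (delta - 1).
have rV : (delta - 1) / delta = r^-1 by rewrite /r invf_div.
have r1 : 1 < r by rewrite /r ltr_pdivlMr //; lra.
have volE j : vol (A j) = \sum_u mu u * (t j <= cmod (g u))%R%:R.
  rewrite /vol big_mkcond; apply: eq_bigr => u _ /=; rewrite inE.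
  by case: ifP; rewrite ?mulr1 // mulr0.
have layer j : c * vol (A j) `^ r^-1 <=
    edge_sum (A j) (fun u v => wt u v * alpha u v) + edge_cut (A j).
  (* An empty layer lies outside the isoperimetric hypothesis; both sides are then 0, the exponent
     being nonzero. *)
  have [->|An] := eqVneq (A j) finset.set0; last first.
    rewrite -rV; apply: le_trans (iso _ An) _.
    by rewrite lerD2r; exact: frus.
  rewrite /vol /edge_sum /edge_cut !big_set0 powR0 ?mulr0 ?mul0r ?addr0 //.
  by rewrite invr_eq0 gt_eqF //; lra.
have mix : \sum_j w j * (edge_sum (A j) (fun u v => wt u v * alpha u v) +
      edge_cut (A j)) = \sum_u \sum_(v | adj u v) wt u v *
    ((\sum_j w j * ((u \in A j)%:R * (v \in A j)%:R)) * alpha u v / 2 +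
     \sum_j w j * ((u \in A j)%:R * (v \in ~: A j)%:R)).
  under eq_bigr => j _.
    rewrite /edge_sum /edge_cut !big_adj_indicator mulr_suml -big_split /=.
    under eq_bigr => u _ do rewrite mulr_suml -big_split /=.
    rewrite mulr_sumr; under eq_bigr => u _ do rewrite mulr_sumr.
    over.
  rewrite exchange_big; apply: eq_bigr => u _ /=.
  rewrite exchange_big; apply: eq_bigr => v _ /=.
  rewrite mulrDr !mulr_suml !mulr_sumr -big_split /=; apply: eq_bigr => j _.
  by ring.
apply: (@le_trans _ _ (\sum_j w j * (c * vol (A j) `^ r^-1))).
  under [leRHS]eq_bigr do rewrite mulrCA.
  rewrite -mulr_sumr ler_wpM2l // rV.
  have := @powR_norm_layer_cake R G (@mu R G) (fun u => cmod (g u)) n w t r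
    (fun u => ltW (mu_gt0 u)) (fun u => cmod_ge0 _ _) w0 gE r1.
  under eq_bigr do rewrite mulrC.
  move=> /le_trans; apply; apply: ler_sum => j _ /=.
  by rewrite volE.
apply: (le_trans (ler_sum _ (fun j _ => ler_wpM2l (w0 j) (layer j)))).
rewrite mix mulr_sumr; apply: ler_sum => u _.
rewrite mulr_sumr; apply: ler_sum => v uv.
rewrite mulrCA ler_wpM2l ?(ltW (wt_gt0 uv)) //.
set D := cmod (g u - s u v * g v).
(* The layers containing both ends are those of the end with the smaller modulus. *)
have sub_min : \sum_j w j * ((u \in A j)%:R * (v \in A j)%:R) =
    Num.min (cmod (g u)) (cmod (g v)).
  have [le|/ltW le] := leP (cmod (g u)) (cmod (g v)).
    rewrite [RHS](gE u); apply: eq_bigr => j _ /=; rewrite !inE.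
    have [tu|_] := leP (t j) (cmod (g u)); last by rewrite mul0r.
    by rewrite (le_trans tu le) mulr1.
  rewrite [RHS](gE v); apply: eq_bigr => j _ /=; rewrite !inE.
  have [tv|_] := leP (t j) (cmod (g v)); last by rewrite mulr0.
  by rewrite (le_trans tv le) mulr1.
(* The layers containing [u] but not [v] have total weight the positive part of |g u| - |g v|. *)
have cut_le : \sum_j w j * ((u \in A j)%:R * (v \in ~: A j)%:R) <=
    `|cmod (g u) - cmod (g v)|.
  have [le|/ltW le] := leP (cmod (g u)) (cmod (g v)).
    rewrite big1 // => j _; rewrite !inE.
    have [tu|_] := leP (t j) (cmod (g u)); last by rewrite mul0r mulr0.
    by rewrite (le_trans tu le) /= !mulr0.
  rewrite ger0_norm ?subr_ge0 // [X in X - _](gE u) [X in _ - X](gE v) -sumrB.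
  apply: ler_sum => j _ /=; rewrite -mulrBr ler_wpM2l // !inE.
  have [tv|_] := leP (t j) (cmod (g v)); last by rewrite mulr1 subr0.
  by rewrite mulr0 (le_trans tv le) subrr.
have sg : cmod (s u v * g v) = cmod (g v).
  have [/mapP[m _ sE] _] := sig u v uv.
  by rewrite cmodM sE xiE cisX cmod_cis mul1r.
have := ler_dist_cmod R (g u) (s u v * g v); rewrite sg -/D => dist.
have := alphaE u v uv; rewrite -/D -sub_min => angle.
by have := le_trans cut_le dist; lra.
Qed.

(** * From p = 1 to larger exponents *)

Lemma hoelder_adj (R : realType) (G : wgraph R) (x y : G -> G -> R) (p q : R) :
  (forall u v, 0 <= x u v) -> (forall u v, 0 <= y u v) ->
  0 < p -> 0 < q -> p^-1 + q^-1 = 1 ->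
  \sum_u \sum_(v | adj u v) wt u v * (x u v * y u v) <=
  (\sum_u \sum_(v | adj u v) wt u v * x u v `^ p) `^ p^-1 *
  (\sum_u \sum_(v | adj u v) wt u v * y u v `^ q) `^ q^-1.
Proof.
move=> x0 y0 p0 q0 pq.
pose m (e : G * G) := if adj e.1 e.2 then wt e.1 e.2 else 0.
have mE (F : G -> G -> R) : \sum_u \sum_(v | adj u v) wt u v * F u v =
    \sum_e m e * F e.1 e.2.
  rewrite -(pair_bigA _ (fun u v => m (u, v) * F u v)); apply: eq_bigr => u _ /=.
  rewrite big_mkcond; apply: eq_bigr => v _ /=; rewrite /m /=.
  by case: ifP; rewrite // mul0r.
rewrite !mE; apply: hoelder_fin => // e; rewrite /m.
by case: ifP => // /wt_gt0/ltW.
Qed.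

(* Young's inequality x^(r-1) y <= x^r / r' + y^r / r bounds the defect
   (x^(r-1) - y^(r-1)) y by (r - 1) x^(r-1) (x - y), even when r < 2. *)
Lemma cmod_powR_scaleB (R : realType) (z w : R[i]) (r : R) : 1 < r ->
  cmod ((cmod z `^ (r - 1))%:C%C * z - (cmod w `^ (r - 1))%:C%C * w) <=
  r * (cmod (z - w) * cmod z `^ (r - 1) + cmod (z - w) * cmod w `^ (r - 1)).
Proof.
move=> r1; wlog wz : z w / cmod w <= cmod z.
  move=> H; have [/H//|/ltW/H] := leP (cmod w) (cmod z).
  rewrite -cmodN opprB => /le_trans; apply.
  by rewrite -(cmodN _ (w - z)) opprB addrC.
have r0 : 0 < r by lra.
have r10 : 0 < r - 1 by lra.
have w0 := cmod_ge0 _ w; have z0 := cmod_ge0 _ z.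
set x := cmod z; set y := cmod w; set D := cmod (z - w).
have xyD : x - y <= D.
  by apply: le_trans (ler_norm _) (ler_dist_cmod _ _ _).
pose X := x `^ (r - 1); pose Y := y `^ (r - 1).
have X0 : 0 <= X by exact: powR_ge0.
have Y0 : 0 <= Y by exact: powR_ge0.
have YX : Y <= X by apply: ge0_ler_powR; rewrite ?nnegrE // ltW.
have young : r * (y * X) <= y * Y + (r - 1) * (x * X).
  have := @conjugate_powR R y X r (r / (r - 1)) w0 X0 r0 (divr_gt0 r0 r10).
  have -> : r^-1 + (r / (r - 1))^-1 = 1 by field; rewrite !gt_eqF.
  move=> /(_ erefl); rewrite /X -powRrM.
  have -> : (r - 1) * (r / (r - 1)) = r by rewrite mulrC divfK ?gt_eqF.
  rewrite -/X -(mulr_powRB1 w0 r0) -(mulr_powRB1 z0 r0) -/x -/X -/y -/Y.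
  move=> /(ler_wpM2l (ltW r0)) /le_trans; apply.
  rewrite le_eqVlt; apply/orP; left; apply/eqP; field.
  by rewrite !gt_eqF.
(* The second summand is the defect: by [young], (X - Y) y <= (r - 1) X (x - y). Together they give
   r D X. *)
have -> : X%:C%C * z - Y%:C%C * w =
    X%:C%C * (z - w) + (X - Y)%:C%C * w :> R[i].
  by rewrite (rmorphB (real_complex R)) /=; ring.
apply: le_trans (ler_cmodD _ _ _) _.
rewrite !cmodM !cmod_real ?subr_ge0 // -/D -/y.
apply: (@le_trans _ _ (r * (D * X))).
  have : (r - 1) * (X * (x - y)) <= (r - 1) * (X * D).
    by rewrite ler_pM2l // ler_wpM2l.
  by lra.
by rewrite ler_pM2l // lerDl mulr_ge0 ?cmod_ge0.
Qed.

Lemma edge_sum_setT (R : realType) (G : wgraph R) (F : G -> G -> R) :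
  \sum_u \sum_(v | adj u v) F u v = 2 * edge_sum [set: G]%SET F.
Proof.
rewrite /edge_sum mulrC divfK ?pnatr_eq0 //.
under [RHS]eq_bigl do rewrite inE.
by apply: eq_bigr => u _; apply: eq_bigl => v; rewrite inE.
Qed.

Lemma degree_le (R : realType) (G : wgraph R) (u : G) :
  degree u <= dmu G * mu u.
Proof. by rewrite -ler_pdivrMr ?mu_gt0 //; exact: le_bigmax. Qed.

Theorem theorem3p8 (R : realType) (p delta q c d : R)
    (hp : 1 <= p) (hpdelta : p < delta) (hc : 0 < c)
    (hq : p^-1 = q^-1 + delta^-1) :
  exists C : R,
    forall (G : wgraph R) (k : nat) (s : G -> G -> R[i]),
      (0 < k)%N ->
      dmu G = d ->
      signature k s ->
      isoperimetric k s delta c ->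
      forall f : G -> R[i],
        (\sum_(u : G) cmod (f u) `^ q * mu u) `^ q^-1 <=
        C * edge_sum finset.setT
              (fun u v => wt u v * cmod (f u - s u v * f v) `^ p) `^ p^-1.
Proof.
have delta1 : 1 < delta by lra.
have p0 : 0 < p by lra.
have d0 : 0 < delta by lra.
have d1 : 0 < delta - 1 by lra.
have qV : q^-1 = p^-1 - delta^-1 by rewrite hq addrK.
have q0 : 0 < q by rewrite -invr_gt0 qV subr_gt0 ltf_pV2.
move: hp; rewrite le_eqVlt => /orP[/eqP p1|p1].
  (* 6 is the 3 of [sobolev_L1] times the two orientations of an edge. *)
  exists (6 / c) => G k s k0 _ sig iso f.
  have qE : q = delta / (delta - 1).
    by rewrite -[LHS]invrK qV -p1; field; rewrite !gt_eqF.
  have qVE : q^-1 = (delta - 1) / delta by rewrite qE invf_div.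
  have := @sobolev_L1 R G k s delta c f k0 sig (ltW hc) delta1 iso.
  rewrite -qE -qVE edge_sum_setT.
  have -> : edge_sum finset.setT
      (fun u v => wt u v * cmod (f u - s u v * f v) `^ p) =
    edge_sum finset.setT (fun u v => wt u v * cmod (f u - s u v * f v)).
    congr (_ / _); apply: eq_bigr => u _; apply: eq_bigr => v _.
    by rewrite -p1 powRr1 ?cmod_ge0.
  rewrite -p1 invr1 powRr1; last first.
    rewrite divr_ge0 // sumr_ge0 // => u _; rewrite sumr_ge0 // => v /andP[_ uv].
    by rewrite mulr_ge0 ?cmod_ge0 ?(ltW (wt_gt0 uv)).
  by rewrite mulrAC ler_pdivlMr // mulrC => H; apply: le_trans H _; lra.
(* [gamma] satisfies both gamma delta / (delta - 1) = q and (gamma - 1) p' = q, so the left side of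
   [sobolev_L1] and the second Hoelder factor are both controlled by the same sum [S]. *)
pose p' := p / (p - 1); move gammaE : (q * (delta - 1) / delta) => gamma.
have p10 : 0 < p - 1 by lra.
have p'0 : 0 < p' by rewrite divr_gt0.
have pp' : p^-1 + p'^-1 = 1 by rewrite /p'; field; rewrite !gt_eqF.
have gammaV : gamma = q - q / delta by rewrite -gammaE; field; rewrite gt_eqF.
have qp : q / p = 1 + q / delta by rewrite hq mulrDr mulfV ?gt_eqF.
have gp' : (gamma - 1) * p' = q.
  have -> : gamma - 1 = q - q / p by rewrite qp gammaV; lra.
  by rewrite /p'; field; rewrite !gt_eqF.
have gamma1 : 1 < gamma.
  by rewrite -subr_gt0 -(pmulr_lgt0 _ p'0) gp'.
have gamma0 : 0 < gamma by lra.
have gr : gamma * (delta / (delta - 1)) = q.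
  by rewrite -gammaE; field; rewrite !gt_eqF.
have qVE : q^-1 = (delta - 1) / delta - p'^-1.
  have -> : p'^-1 = 1 - p^-1 by rewrite -pp' addrC addKr.
  by rewrite qV; field; rewrite !gt_eqF.
(* 3 comes from [sobolev_L1], 2 gamma from the two terms of [cmod_powR_scaleB], 2^(1/p) from the two
   orientations, d^(1/p') from the degree bound. *)
exists (6 * gamma * 2 `^ p^-1 * d `^ p'^-1 / c) => G k s k0 dE sig iso f.
set S := \sum_(u : G) _; set E := edge_sum _ _.
have S0 : 0 <= S by apply: sumr_ge0 => u _; rewrite mulr_ge0 ?powR_ge0 ?ltW ?mu_gt0.
(* For [S] = 0 the claim is trivial; otherwise a power of [S] can be divided out at the end. *)
have [Sz|Sn] := eqVneq S 0.
  rewrite Sz powR0 ?invr_eq0 ?gt_eqF //.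
  by rewrite !mulr_ge0 ?powR_ge0 ?invr_ge0 ?(ltW gamma0) ?(ltW hc).
have {Sn}S0 : 0 < S by rewrite lt_def Sn.
have d_ge0 : 0 <= d by rewrite -dE /dmu; exact: bigmax_ge_id.
pose D u v := cmod (f u - s u v * f v).
have D0 u v : 0 <= D u v by exact: cmod_ge0.
have E0 : 0 <= E.
  rewrite divr_ge0 // sumr_ge0 // => u _; rewrite sumr_ge0 // => v /andP[_ uv].
  by rewrite mulr_ge0 ?powR_ge0 ?(ltW (wt_gt0 uv)).
pose g u := (cmod (f u) `^ (gamma - 1))%:C%C * f u.
have gmod u : cmod (g u) = cmod (f u) `^ gamma.
  by rewrite cmodM cmod_real ?powR_ge0 // mulrC mulr_powRB1 ?cmod_ge0.
have := @sobolev_L1 R G k s delta c g k0 sig (ltW hc) delta1 iso.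
under eq_bigr do rewrite gmod -powRrM gr.
rewrite -/S => L1.
have sf u v : adj u v -> cmod (s u v * f v) = cmod (f v).
  by move=> uv; have [/mapP[m _ sE] _] := sig u v uv;
    rewrite cmodM sE xiE cisX cmod_cis mul1r.
(* Summing the weights over [v] gives the degree of [u], at most [d * mu u]. *)
have massl : \sum_u \sum_(v | adj u v) wt u v * (cmod (f u) `^ (gamma - 1)) `^ p'
    <= d * S.
  rewrite mulr_sumr; apply: ler_sum => u _; rewrite -mulr_suml -powRrM gp'.
  by rewrite mulrCA mulrC ler_wpM2l ?powR_ge0 // -dE degree_le.
have massr : \sum_u \sum_(v | adj u v) wt u v * (cmod (f v) `^ (gamma - 1)) `^ p'
    <= d * S.
  rewrite (exchange_big_dep xpredT) //=; apply: le_trans massl.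
  apply: ler_sum => v _; rewrite le_eqVlt; apply/orP; left; apply/eqP.
  under eq_bigl do rewrite adj_sym.
  by apply: eq_bigr => u uv; rewrite wt_sym // adj_sym.
have hoelder (h : G -> G -> R) : (forall u v, 0 <= h u v) ->
    \sum_u \sum_(v | adj u v) wt u v * h u v `^ p' <= d * S ->
    \sum_u \sum_(v | adj u v) wt u v * (D u v * h u v) <=
    (2 * E) `^ p^-1 * (d * S) `^ p'^-1.
  move=> h0 hS; apply: le_trans (@hoelder_adj R G D h p p' D0 h0 p0 p'0 pp') _.
  rewrite edge_sum_setT -/E ler_wpM2l ?powR_ge0 // ge0_ler_powR ?nnegrE //.
  - by rewrite invr_ge0 ltW.
  - apply: sumr_ge0 => u _; apply: sumr_ge0 => v uv.
    by rewrite mulr_ge0 ?powR_ge0 ?(ltW (wt_gt0 uv)).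
  - by rewrite mulr_ge0 // ltW.
have Hl := hoelder (fun u _ => cmod (f u) `^ (gamma - 1))
  (fun _ _ => powR_ge0 _ _) massl.
have Hr := hoelder (fun _ v => cmod (f v) `^ (gamma - 1))
  (fun _ _ => powR_ge0 _ _) massr.
have L : \sum_u \sum_(v | adj u v) wt u v * cmod (g u - s u v * g v) <=
    2 * gamma * ((2 * E) `^ p^-1 * (d * S) `^ p'^-1).
  apply: (@le_trans _ _ (gamma * (
     \sum_u \sum_(v | adj u v) wt u v * (D u v * cmod (f u) `^ (gamma - 1)) +
     \sum_u \sum_(v | adj u v) wt u v * (D u v * cmod (f v) `^ (gamma - 1))))).
    rewrite -big_split mulr_sumr; apply: ler_sum => u _ /=.
    rewrite -big_split mulr_sumr; apply: ler_sum => v uv /=.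
    rewrite -mulrDr [leRHS]mulrCA ler_wpM2l ?(ltW (wt_gt0 uv)) //.
    have := @cmod_powR_scaleB R (f u) (s u v * f v) gamma gamma1.
    by rewrite sf // [s u v * g v]mulrCA.
  by rewrite [2 * _]mulrC -mulrA ler_pM2l // mulr_natl mulr2n lerD.
have {L L1} := le_trans L1 (ler_wpM2l (ler0n _ 3) L).
rewrite (powRM _ (ler0n _ 2) E0) (powRM _ d_ge0 (ltW S0)).
(* As 1/q = (delta - 1)/delta - 1/p', dividing by S^(1/p') leaves S^(1/q). *)
rewrite qVE powRB ?(gt_eqF S0) ?implybT // => L.
rewrite ler_pdivrMr ?powR_gt0 // -(ler_pM2l hc); apply: le_trans L _.
rewrite le_eqVlt; apply/orP; left; apply/eqP.
move: (E `^ _) (S `^ _) (2 `^ _) (d `^ _) => x y z t.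
by field; rewrite gt_eqF.
Qed.
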